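(* Let $n\ge 1$ be an integer and let $\Omega\subset\mathbb{R}$ be a nonempty open set. (1) Let $S=\Omega-\Omega=\{x-y:x,y\in\Omega\}$ and let $f:S\to\mathbb{C}$ be a positive definite function. If $f$ is of class $C^{2n}$ in an open set $U\subseteq S$ containing $D_\Omega(S)=\{0\}$, then $f$ is of class $C^{2n}$ in $S$. (2) Let $S=\Omega+\Omega=\{x+y:x,y\in\Omega\}$ and let $f:S\to\mathbb{C}$ be a co-positive definite function. If $f$ is of class $C^{2n}$ in an open set $U\subseteq S$ containing $D_\Omega(S)=\{x+x:x\in\Omega\}$, then $f$ is of class $C^{2n}$ in $S$.
   Context: A function $f:\Omega-\Omega\to\mathbb{C}$ is positive definite if $\sum_{i,j=1}^m f(x_i-x_j)\,\xi_i\,\overline{\xi_j}\ge 0$ for every $m\in\mathbb{N}$ and all finite collections $\{x_j\}_{j=1}^m\subset\Omega$ and $\{\xi_j\}_{j=1}^m\subset\mathbb{C}$. A function $f:\Omega+\Omega\to\mathbb{C}$ is co-positive definite (also called exponentially convex) if $\sum_{i,j=1}^m f(x_i+x_j)\,\xi_i\,\overline{\xi_j}\ge 0$ for every $m\in\mathbb{N}$ and all finite collections $\{x_j\}_{j=1}^m\subset\Omega$ and $\{\xi_j\}_{j=1}^m\subset\mathbb{C}$. *)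

(* Defs.v *)
From Stdlib Require Import Reals.
From Coquelicot Require Import Coquelicot.
Local Open Scope R_scope.

(* Functions on a subset of R are represented by total functions R -> C; every
   notion below only looks at the values (or, on an open set, at the germs) of
   the function on the set in question. *)

Definition diff_set (Omega : R -> Prop) : R -> Prop :=
  fun s => exists x y, Omega x /\ Omega y /\ s = x - y.

Definition sum_set (Omega : R -> Prop) : R -> Prop :=
  fun s => exists x y, Omega x /\ Omega y /\ s = x + y.

Definition C_nonneg (z : C) : Prop := 0 <= Re z /\ Im z = 0.

Definition positive_definite (Omega : R -> Prop) (f : R -> C) : Prop :=
  forall (m : nat) (x : nat -> R) (xi : nat -> C),
    (forall j : nat, (1 <= j <= m)%nat -> Omega (x j)) ->
    C_nonneg
      (sum_n_m (fun i => sum_n_m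
         (fun j => (f (x i - x j)%R * xi i * Cconj (xi j))%C) 1 m) 1 m).

Definition co_positive_definite (Omega : R -> Prop) (f : R -> C) : Prop :=
  forall (m : nat) (x : nat -> R) (xi : nat -> C),
    (forall j : nat, (1 <= j <= m)%nat -> Omega (x j)) ->
    C_nonneg
      (sum_n_m (fun i => sum_n_m
         (fun j => (f (x i + x j)%R * xi i * Cconj (xi j))%C) 1 m) 1 m).

(* Intended for open U only: continuity and derivatives are taken in R, not
   relative to U. The variable is real, so C is viewed as a normed space over R. *)
Fixpoint class_C (k : nat) (U : R -> Prop) (f : R -> C) : Prop :=
  match k with
  | O => forall x : R, U x -> continuous f x
  | S k' => exists f' : R -> C,
      (forall x : R, U x ->
         is_derive (K := R_AbsRing) (V := C_R_NormedModule) f x (f' x)) /\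
      class_C k' U f'
  end.

(* Main.v *)
Require Import Defs.
From Stdlib Require Import Reals Lra Lia List ClassicalEpsilon.
From Coquelicot Require Import Coquelicot.
Local Open Scope R_scope.

(** Both cases are about the kernel [K(x, y) = f (x + sigma * y)] on [Omega],
    with [sigma = -1] for positive definite and [sigma = 1] for co-positive
    definite functions; the hypothesis says that [K] is positive semidefinite.
    Such a kernel is a Gram kernel [K(x, y) = <k_x, k_y>] of vectors in some
    Hilbert space, and the behaviour of [K] near the diagonal governs the
    vectors [k_x] themselves, hence [K] everywhere.

    Continuity illustrates this: if [f] is continuous at [a + sigma * a], then
    [|k_x - k_a|^2] tends to [0] as [x] tends to [a], and by Cauchy-Schwarz
    [f (x + sigma * b) = <k_x, k_b>] tends to [<k_a, k_b>] for every [b] in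
    [Omega].  For derivatives, replace [k_x] by the difference quotient
    [d_h = (k_(a+h) - k_a) / h].  The scalar products [<d_h, d_t>] are second
    difference quotients of [f] at [a + sigma * a]; if [f] is C^2 there, they
    converge to [sigma * f''(a + sigma * a)] as [h] and [t] tend to [0]
    independently, so that [d_h] is a Cauchy family.  Then [<d_h, k_b>]
    converges, which gives [f'] at [a + sigma * b], and so do the products of
    [d_h] with the difference quotients at [b], which gives [f''] there.
    Moreover [sigma * f''(x + sigma * y)] is a limit of Gram kernels, hence
    positive semidefinite again.  So [sigma * f''] satisfies the hypotheses of
    the theorem with [n - 1] in place of [n], and an induction which starts at
    [n = 0], the case of continuity, finishes the proof.

    The Hilbert space need not be built: a finite formal combination of the
    [k_x] is a list of pairs (coefficient, point), on which the kernel induces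
    a sesquilinear form ([form]) satisfying Cauchy-Schwarz.  The principle
    that convergence of Gram products within two families forces convergence
    of the products between them is [gram_limit_ex]; it is stated for
    arbitrary filters, so that it serves all three uses above. *)

(** * Limits of complex-valued functions *)

Lemma filterlim_Cmod {T} {F : (T -> Prop) -> Prop} {FF : Filter F} (f : T -> C) (l : C) :
  filterlim f F (locally l) <-> forall eps : posreal, F (fun x => Cmod (f x - l) < eps).
Proof. exact (@filterlim_locally_ball_norm C_AbsRing T C_NormedModule F FF f l). Qed.

(** The derivative in [class_C] refers to the norm of the product space R * R,
    which this identifies with the modulus. *)
Lemma norm_C_R (z : C) : @norm R_AbsRing C_R_NormedModule z = Cmod z.
Proof.
  unfold norm, Cmod; simpl; unfold prod_norm, norm; simpl; unfold abs; simpl.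
  f_equal. rewrite !Rmult_1_r, <- !Rabs_mult, !Rabs_pos_eq by apply Rle_0_sqr. reflexivity.
Qed.

(** Difference quotients are the form in which derivatives arise as scalar
    products below. *)
Lemma is_derive_quot (f : R -> C) (x : R) (l : C) :
  is_derive (K := R_AbsRing) (V := C_R_NormedModule) f x l <->
  filterlim (fun h : R => (f (x + h)%R - f x) / h)%C (locally' 0) (locally l).
Proof.
  assert (E : forall h, h <> 0 -> Cmod ((f (x + h)%R - f x) / h - l) * Rabs h
     = @norm R_AbsRing C_R_NormedModule
        (minus (minus (f (x + h)) (f x)) (scal (minus (x + h) x) l))).
  { intros h h0. rewrite norm_C_R, <- Cmod_R, <- Cmod_mult. f_equal.
    assert (hC : RtoC h <> 0%C) by (intros K; apply RtoC_inj in K; auto).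
    transitivity (f (x + h)%R - f x - h * l)%C; [field; auto|].
    apply injective_projections; unfold minus, plus, opp, scal; simpl;
      unfold prod_plus, prod_opp, prod_scal, plus, opp, scal; simpl;
      unfold mult; simpl; ring. }
  rewrite filterlim_Cmod. split.
  - intros [_ H] eps.
    destruct (H x (fun P HP => HP) (pos_div_2 eps)) as [d Hd].
    exists d. intros h Bh h0.
    assert (hp := Rabs_pos_lt h h0).
    apply Rmult_lt_reg_r with (Rabs h); auto.
    rewrite E by auto.
    assert (e : x + h - x = h) by apply Rplus_minus_l.
    assert (B : ball x d (x + h)).
    { change (Rabs (x + h - x) < d). change (Rabs (h - 0) < d) in Bh.
      now rewrite Rminus_0_r in Bh; rewrite e. }
    apply Rle_lt_trans with (1 := Hd _ B).
    change (eps / 2 * Rabs (x + h - x) < eps * Rabs h).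
    rewrite e. destruct eps as [r hr]; simpl. nra.
  - intros H. split; [apply is_linear_scal_l|].
    intros y Hy.
    replace y with x by (apply is_filter_lim_locally_unique; auto).
    intros eps. destruct (H eps) as [d Hd]. exists d. intros z Bz.
    change (@norm R_AbsRing C_R_NormedModule
      (minus (minus (f z) (f x)) (scal (minus z x) l)) <= eps * Rabs (z - x)).
    destruct (Req_dec z x) as [->|zx].
    + assert (e : Rabs (x - x) = 0) by (rewrite Rminus_diag; apply Rabs_R0).
      rewrite e, Rmult_0_r. right.
      rewrite norm_C_R, <- Cmod_0. f_equal.
      apply injective_projections; unfold minus, plus, opp, scal; simpl;
        unfold prod_plus, prod_opp, prod_scal, plus, opp, scal; simpl;
        unfold mult; simpl; ring.
    + assert (h0 : z - x <> 0) by lra.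
      specialize (E (z - x) h0). specialize (Hd (z - x)).
      assert (e : x + (z - x) = z) by apply Rplus_minus. rewrite e in E, Hd.
      eapply Rle_trans; [right; symmetry; exact E|].
      apply Rmult_le_compat_r; [apply Rabs_pos|]. left; apply Hd; auto.
      change (Rabs (z - x) < d) in Bz. change (Rabs (z - x - 0) < d).
      now rewrite Rminus_0_r.
Qed.

Lemma ex_filterlim_Cauchy {T} {F : (T -> Prop) -> Prop} {FF : ProperFilter F} (f : T -> C) :
  (forall eps : posreal, exists P, F P /\ forall u v, P u -> P v -> Cmod (f u - f v) < eps) ->
  exists l, filterlim f F (locally l).
Proof.
  intros H. apply (filterlim_locally_cauchy (U := C_CompleteNormedModule) f).
  intros eps. destruct (H eps) as [P [HP H']]. exists P; split; auto.
  intros u v Pu Pv. apply (norm_compat1 (V := C_NormedModule)). now apply H'.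
Qed.

Lemma filterlim_C_unique {T} {F : (T -> Prop) -> Prop} {FF : ProperFilter F}
    (f : T -> C) (l l' : C) :
  filterlim f F (locally l) -> filterlim f F (locally l') -> l = l'.
Proof. exact (filterlim_locally_unique (V := C_NormedModule) f l l'). Qed.

Lemma filterlim_C_plus {T} {F : (T -> Prop) -> Prop} {FF : Filter F}
    (f g : T -> C) (l m : C) :
  filterlim f F (locally l) -> filterlim g F (locally m) ->
  filterlim (fun x => f x + g x)%C F (locally (l + m)%C).
Proof.
  intros Hf Hg. eapply filterlim_comp_2; [exact Hf|exact Hg|].
  exact (filterlim_plus (V := C_NormedModule) l m).
Qed.

Lemma filterlim_C_scal {T} {F : (T -> Prop) -> Prop} {FF : Filter F}
    (c : C) (f : T -> C) (l : C) :
  filterlim f F (locally l) ->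
  filterlim (fun x => c * f x)%C F (locally (c * l)%C).
Proof.
  intros Hf. eapply filterlim_comp; [exact Hf|].
  exact (filterlim_scal_r (V := C_NormedModule) c l).
Qed.

Lemma filterlim_C_nonneg {T} {F : (T -> Prop) -> Prop} {FF : ProperFilter F}
    (f : T -> C) (l : C) :
  F (fun x => C_nonneg (f x)) -> filterlim f F (locally l) -> C_nonneg l.
Proof.
  intros Hp Hl. rewrite filterlim_Cmod in Hl.
  assert (A : forall eps, 0 < eps -> - eps < Re l /\ Rabs (Im l) < eps).
  { intros eps He.
    destruct (filter_ex _ (filter_and _ _ Hp (Hl (mkposreal eps He))))
      as [x [[Rx Ix] Hx]]. simpl in Hx.
    assert (M := Rmax_Cmod (f x - l)%C).
    assert (M1 := Rmax_l (Rabs (fst (f x - l)%C)) (Rabs (snd (f x - l)%C))).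
    assert (M2 := Rmax_r (Rabs (fst (f x - l)%C)) (Rabs (snd (f x - l)%C))).
    destruct (f x) as [a b], l as [a' b']. simpl in *. subst b.
    assert (H1 : Rabs (a + - a') < eps) by lra. apply Rabs_def2 in H1.
    split; [lra|]. rewrite <- Rabs_Ropp, <- (Rplus_0_l (- b')). lra. }
  split.
  - destruct (Rle_lt_dec 0 (Re l)) as [|N]; auto.
    destruct (A (- Re l)); lra.
  - destruct (Req_dec (Im l) 0) as [|N]; auto.
    apply Rabs_pos_lt in N. destruct (A _ N); lra.
Qed.

#[local] Instance locally'_proper (x : R) : ProperFilter (locally' x).
Proof. exact (Rbar_locally'_filter (Finite x)). Qed.

Lemma locally'_nbhd (x : R) (P : R -> Prop) :
  locally x P -> locally' 0 (fun h => P (x + h)).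
Proof.
  intros [d Hd]. exists d. intros h Bh _. apply Hd.
  change (Rabs (x + h - x) < d). change (Rabs (h - 0) < d) in Bh.
  assert (e : x + h - x = h - 0) by (unfold Rminus; rewrite Ropp_0, Rplus_0_r; apply Rplus_minus_l).
  now rewrite e.
Qed.

Lemma locally'_neq (x : R) : locally' x (fun y => y <> x).
Proof. exists (mkposreal 1 Rlt_0_1). auto. Qed.

Lemma filterlim_locally'_scal (c : R) :
  c <> 0 -> filterlim (fun h => c * h) (locally' 0) (locally' 0).
Proof.
  intros c0 P [d Hd].
  assert (He : 0 < d / Rabs c).
  { apply Rdiv_lt_0_compat; [apply cond_pos|now apply Rabs_pos_lt]. }
  exists (mkposreal _ He). intros h Bh h0. apply Hd.
  - change (Rabs (c * h - 0) < d). change (Rabs (h - 0) < d / Rabs c) in Bh.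
    rewrite Rminus_0_r in *. rewrite Rabs_mult.
    assert (H := Rabs_pos_lt c c0).
    apply Rmult_lt_compat_l with (r := Rabs c) in Bh; auto.
    field_simplify in Bh; lra.
  - now apply Rmult_integral_contrapositive_currified.
Qed.

(** * Second differences *)

Definition second_diff (f : R -> C) (s : R) (ht : R * R) : C :=
  ((f (s + fst ht + snd ht)%R - f (s + fst ht)%R - f (s + snd ht)%R + f s)
   / (fst ht * snd ht)%R)%C.

Lemma is_derive_continuity_pt (f : R -> R) (x l : R) :
  is_derive f x l -> continuity_pt f x.
Proof.
  intros H. apply derivable_continuous_pt. exists l. now apply is_derive_Reals.
Qed.

(** The mean value theorem is applied once to [x |-> f (x + t) - f x] and once to
    [f1].  The increments take both signs, since [t] stands for [sigma] times
    the increment of a variable. *)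
Lemma second_diff_MVT (f f1 f2 : R -> R) (s d h t : R) :
  (forall x, Rabs (x - s) < d -> is_derive f x (f1 x)) ->
  (forall x, Rabs (x - s) < d -> is_derive f1 x (f2 x)) ->
  Rabs h + Rabs t < d ->
  exists c, Rabs (c - s) < d /\
    f (s + h + t) - f (s + h) - f (s + t) + f s = f2 c * (h * t).
Proof.
  intros H1 H2 Hd.
  assert (near : forall a k c, Rmin a (a + k) <= c <= Rmax a (a + k) ->
    Rabs (c - a) <= Rabs k).
  { intros a k c. unfold Rmin, Rmax. repeat destruct Rle_dec; unfold Rabs in *;
      repeat destruct Rcase_abs; lra. }
  assert (tri : forall a c, Rabs (a - s) <= Rabs h -> Rabs (c - a) <= Rabs t ->
    Rabs (c - s) < d).
  { intros a c Ha Hc. assert (H := Rabs_triang (c - a) (a - s)).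
    replace (c - a + (a - s)) with (c - s) in H by ring. lra. }
  assert (D1 : forall x, Rmin s (s + h) <= x <= Rmax s (s + h) ->
    is_derive (fun x => f (x + t) - f x) x (f1 (x + t) - f1 x)).
  { intros x Hx. apply near in Hx.
    apply (is_derive_minus (V := R_NormedModule) (fun x => f (x + t)) f).
    - rewrite <- (Rmult_1_l (f1 (x + t))).
      apply (is_derive_comp (V := R_NormedModule) f (fun x => x + t)).
      + apply H1, (tri x); auto. replace (x + t - x) with t by ring. lra.
      + auto_derive; auto.
    - apply H1, (tri x); auto. rewrite Rminus_diag, Rabs_R0. apply Rabs_pos. }
  destruct (MVT_gen (fun x => f (x + t) - f x) s (s + h) (fun x => f1 (x + t) - f1 x))
    as [c1 [Hc1 E1]].
  - intros x Hx. apply D1. lra.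
  - intros x Hx. eapply is_derive_continuity_pt. now apply D1.
  - apply near in Hc1.
    assert (D2 : forall x, Rmin c1 (c1 + t) <= x <= Rmax c1 (c1 + t) ->
      is_derive f1 x (f2 x)).
    { intros x Hx. apply H2, (tri c1); auto. }
    destruct (MVT_gen f1 c1 (c1 + t) f2) as [c2 [Hc2 E2]].
    + intros x Hx. apply D2. lra.
    + intros x Hx. eapply is_derive_continuity_pt. now apply D2.
    + exists c2. split.
      * apply (tri c1); auto.
      * rewrite E2 in E1. lra.
Qed.

Lemma is_derive_Re (f : R -> C) (x : R) (l : C) :
  is_derive (K := R_AbsRing) (V := C_R_NormedModule) f x l ->
  is_derive (fun y => Re (f y)) x (Re l).
Proof.
  intros H.
  exact (filterdiff_comp' (V := C_R_NormedModule) f fst x _ fst H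
    (filterdiff_linear (U := C_R_NormedModule) fst is_linear_fst)).
Qed.

Lemma is_derive_Im (f : R -> C) (x : R) (l : C) :
  is_derive (K := R_AbsRing) (V := C_R_NormedModule) f x l ->
  is_derive (fun y => Im (f y)) x (Im l).
Proof.
  intros H.
  exact (filterdiff_comp' (V := C_R_NormedModule) f snd x _ snd H
    (filterdiff_linear (U := C_R_NormedModule) snd is_linear_snd)).
Qed.

(** The mean value theorem fails for complex values, so it is applied to the real
    and imaginary parts, at two possibly different intermediate points. *)
Lemma second_diff_limit (f f1 f2 : R -> C) (s : R) :
  locally s (fun x =>
    is_derive (K := R_AbsRing) (V := C_R_NormedModule) f x (f1 x)) ->
  locally s (fun x =>
    is_derive (K := R_AbsRing) (V := C_R_NormedModule) f1 x (f2 x)) ->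
  continuous f2 s ->
  filterlim (second_diff f s) (filter_prod (locally' 0) (locally' 0))
    (locally (f2 s)).
Proof.
  intros H1 H2 H3. apply filterlim_Cmod. intros eps.
  assert (He := cond_pos eps).
  assert (H3' := proj1 (filterlim_Cmod _ _) H3 (pos_div_2 eps)).
  destruct (filter_and _ _ H1 (filter_and _ _ H2 H3')) as [d Hd].
  simpl in Hd.
  assert (near : locally' 0 (fun h => Rabs h < d / 2 /\ h <> 0)).
  { exists (pos_div_2 d). intros h Bh h0. split; auto.
    change (Rabs (h - 0) < d / 2) in Bh. now rewrite Rminus_0_r in Bh. }
  eapply Filter_prod; [exact near|exact near|].
  intros h t [Hh h0] [Ht t0].
  assert (Hht : Rabs h + Rabs t < d) by lra.
  destruct (second_diff_MVT (fun x => Re (f x)) (fun x => Re (f1 x))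
    (fun x => Re (f2 x)) s d h t) as [c [Bc Ec]]; auto.
  { intros x Hx. now apply is_derive_Re, Hd. }
  { intros x Hx. now apply is_derive_Re, Hd. }
  destruct (second_diff_MVT (fun x => Im (f x)) (fun x => Im (f1 x))
    (fun x => Im (f2 x)) s d h t) as [c' [Bc' Ec']]; auto.
  { intros x Hx. now apply is_derive_Im, Hd. }
  { intros x Hx. now apply is_derive_Im, Hd. }
  assert (ht0 : h * t <> 0) by now apply Rmult_integral_contrapositive_currified.
  assert (E : second_diff f s (h, t) = (Re (f2 c), Im (f2 c'))).
  { unfold second_diff; simpl fst; simpl snd.
    transitivity ((Re (f2 c), Im (f2 c')) * (h * t)%R / (h * t)%R)%C.
    - f_equal. apply injective_projections; simpl.
      + transitivity (Re (f2 c) * (h * t)); [rewrite <- Ec; unfold Re; ring|unfold Re; ring].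
      + transitivity (Im (f2 c') * (h * t)); [rewrite <- Ec'; unfold Im; ring|unfold Im; ring].
    - field. intros K. apply RtoC_inj in K. auto. }
  rewrite E.
  destruct (Hd c Bc) as [_ [_ Rc]]. destruct (Hd c' Bc') as [_ [_ Ic]].
  assert (M := Rle_trans _ _ _ (Rmax_l _ _) (Rmax_Cmod (f2 c - f2 s)%C)).
  assert (M' := Rle_trans _ _ _ (Rmax_r _ _) (Rmax_Cmod (f2 c' - f2 s)%C)).
  (* [Cmod_2Rmax] bounds the modulus by [sqrt 2] times the larger component,
     which is below [eps / 2]. *)
  eapply Rle_lt_trans; [apply Cmod_2Rmax|].
  assert (S2 : sqrt 2 < 2).
  { rewrite <- (sqrt_pow2 2) at 2 by lra. apply sqrt_lt_1_alt. lra. }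
  simpl in *.
  assert (Mx : Rmax (Rabs (Re (f2 c) + - fst (f2 s))) (Rabs (Im (f2 c') + - snd (f2 s))) < eps / 2).
  { apply Rmax_lub_lt; unfold Re, Im; lra. }
  assert (M0 := Rle_trans _ _ _ (Rabs_pos (Re (f2 c) + - fst (f2 s)))
    (Rmax_l _ (Rabs (Im (f2 c') + - snd (f2 s))))).
  nra.
Qed.

(** Letting [h] tend to [0] first, for fixed [t], turns the second difference
    quotient into the difference quotient of [f1] with increment [t]. *)
Lemma is_derive_of_second_diff (f f1 : R -> C) (s : R) (m : C) :
  locally s (fun x =>
    is_derive (K := R_AbsRing) (V := C_R_NormedModule) f x (f1 x)) ->
  filterlim (second_diff f s) (filter_prod (locally' 0) (locally' 0))
    (locally m) ->
  is_derive (K := R_AbsRing) (V := C_R_NormedModule) f1 s m.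
Proof.
  intros H1 H2. apply is_derive_quot, filterlim_Cmod. intros eps.
  assert (He := cond_pos eps).
  assert (swap : forall a b c : R, a + b + c = a + c + b) by (intros; ring).
  set (e2 := pos_div_2 eps).
  destruct (proj1 (filterlim_Cmod _ _) H2 e2) as [P Q HP HQ H].
  assert (Ds := locally_singleton _ _ H1).
  generalize (filter_and _ _ HQ
    (filter_and _ _ (locally'_neq 0) (locally'_nbhd s _ H1))).
  apply filter_imp. intros t [Qt [t0 Dt]].
  apply is_derive_quot in Dt. apply is_derive_quot in Ds.
  assert (t0' : RtoC t <> 0%C) by (intros K; apply RtoC_inj in K; auto).
  assert (L : filterlim (fun h => second_diff f s (h, t)) (locally' 0)
    (locally (/ t * (f1 (s + t)%R + (-1) * f1 s))%C)).
  { apply filterlim_ext_loc with (f := fun h : R =>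
      (/ t * ((f (s + t + h)%R - f (s + t)%R) / h + (-1) * ((f (s + h)%R - f s) / h)))%C).
    - generalize (locally'_neq 0). apply filter_imp. intros h h0.
      assert (h0' : RtoC h <> 0%C) by (intros K; apply RtoC_inj in K; auto).
      unfold second_diff; simpl. rewrite RtoC_mult.
      rewrite (swap s h t). field. auto.
    - now apply filterlim_C_scal, filterlim_C_plus, filterlim_C_scal. }
  destruct (filter_ex _ (filter_and _ _ HP (proj1 (filterlim_Cmod _ _) L e2)))
    as [h [Ph Lh]].
  specialize (H h t Ph Qt). rewrite <- Cmod_opp in Lh.
  replace ((f1 (s + t)%R - f1 s) / t - m)%C with
    (- (second_diff f s (h, t) - / t * (f1 (s + t)%R + (-1) * f1 s))
     + (second_diff f s (h, t) - m))%C by (field; auto).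
  eapply Rle_lt_trans; [apply Cmod_triangle|]. simpl in *. lra.
Qed.

(** * The sesquilinear form of a positive semidefinite kernel *)

Definition lsum {T : Type} (g : T -> C) (u : list T) : C :=
  fold_right (fun p s => g p + s)%C 0%C u.

Lemma lsum_ext {T} (g h : T -> C) (u : list T) :
  (forall p, In p u -> g p = h p) -> lsum g u = lsum h u.
Proof.
  induction u as [|p u IH]; intros H; simpl; auto.
  rewrite IH, (H p); simpl; auto. intros q Hq; apply H; simpl; auto.
Qed.

Lemma lsum_app {T} (g : T -> C) (u v : list T) :
  lsum g (u ++ v) = (lsum g u + lsum g v)%C.
Proof. induction u as [|p u IH]; simpl; [ring|rewrite IH; ring]. Qed.

Lemma lsum_plus {T} (g h : T -> C) (u : list T) :
  lsum (fun p => g p + h p)%C u = (lsum g u + lsum h u)%C.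
Proof. induction u as [|p u IH]; simpl; [ring|rewrite IH; ring]. Qed.

Lemma lsum_scal {T} (c : C) (g : T -> C) (u : list T) :
  lsum (fun p => c * g p)%C u = (c * lsum g u)%C.
Proof. induction u as [|p u IH]; simpl; [ring|rewrite IH; ring]. Qed.

Lemma lsum_map {S T} (k : S -> T) (g : T -> C) (u : list S) :
  lsum g (map k u) = lsum (fun p => g (k p)) u.
Proof. induction u as [|p u IH]; simpl; [|rewrite IH]; auto. Qed.

Lemma lsum_flat_map {S T} (k : S -> list T) (g : T -> C) (u : list S) :
  lsum g (flat_map k u) = lsum (fun p => lsum g (k p)) u.
Proof. induction u as [|p u IH]; simpl; [|rewrite lsum_app, IH]; auto. Qed.

Lemma filterlim_lsum {T I} {F : (I -> Prop) -> Prop} {FF : Filter F}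
    (g : I -> T -> C) (l : T -> C) (u : list T) :
  (forall p, In p u -> filterlim (fun i => g i p) F (locally (l p))) ->
  filterlim (fun i => lsum (g i) u) F (locally (lsum l u)).
Proof.
  induction u as [|p u IH]; intros H; simpl.
  - apply filterlim_const.
  - apply filterlim_C_plus; [apply H; simpl; auto|].
    apply IH; intros; apply H; simpl; auto.
Qed.

Section Form.
Context {T : Type} (K : T -> T -> C).

(** The list [[(c1, x1); ...; (cn, xn)]] stands for the vector
    [c1 k_(x1) + ... + cn k_(xn)], where [<k_x, k_y> = K x y]; [form] is the
    scalar product of two such vectors.  Addition is concatenation, so lists
    that represent the same vector may differ; only [form] matters. *)
Definition form (u v : list (C * T)) : C :=
  lsum (fun p => lsum (fun q =>
    K (snd p) (snd q) * fst p * Cconj (fst q))%C v) u.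

Definition lscal (c : C) (u : list (C * T)) : list (C * T) :=
  map (fun p => (c * fst p, snd p)%C) u.

Lemma form_app_l u u' v : form (u ++ u') v = (form u v + form u' v)%C.
Proof. apply lsum_app. Qed.

Lemma form_app_r u v v' : form u (v ++ v') = (form u v + form u v')%C.
Proof.
  unfold form. rewrite <- lsum_plus. apply lsum_ext. intros; apply lsum_app.
Qed.

Lemma form_lscal_l c u v : form (lscal c u) v = (c * form u v)%C.
Proof.
  unfold form, lscal. rewrite lsum_map, <- lsum_scal. apply lsum_ext; intros p _.
  rewrite <- lsum_scal. apply lsum_ext; intros q _. simpl. ring.
Qed.

Lemma form_lscal_r c u v : form u (lscal c v) = (Cconj c * form u v)%C.
Proof.
  unfold form, lscal. rewrite <- lsum_scal. apply lsum_ext; intros p _.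
  rewrite lsum_map, <- lsum_scal. apply lsum_ext; intros q _. simpl.
  rewrite Cmult_conj. ring.
Qed.

Lemma form_flat_map_r {S} (k : S -> list (C * T)) u (v : list S) :
  form u (flat_map k v) = lsum (fun p => form u (k p)) v.
Proof.
  induction v as [|q v IH]; simpl.
  - induction u as [|p u IHu]; simpl in *; [auto|rewrite IHu; ring].
  - now rewrite form_app_r, IH.
Qed.

Definition supported (Om : T -> Prop) (u : list (C * T)) : Prop :=
  List.Forall (fun p => Om (snd p)) u.

Lemma supported_app Om u v :
  supported Om u -> supported Om v -> supported Om (u ++ v).
Proof. intros; apply Forall_app; auto. Qed.

Lemma supported_lscal Om c u : supported Om u -> supported Om (lscal c u).
Proof. intros H. unfold supported, lscal. now apply Forall_map. Qed.

Definition psd_kernel (Om : T -> Prop) : Prop :=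
  forall u, supported Om u -> C_nonneg (form u u).

Context {Om : T -> Prop} (HK : psd_kernel Om).

Lemma form_combination u v c :
  form (u ++ lscal c v) (u ++ lscal c v)
  = (form u u + Cconj c * form u v + c * form v u + c * Cconj c * form v v)%C.
Proof.
  rewrite form_app_l, !form_app_r, !form_lscal_l, !form_lscal_r. ring.
Qed.

(** The form is real on the diagonal; its imaginary parts at [u + v] and at
    [u + i v] give the two components of the symmetry. *)
Lemma form_hermitian u v :
  supported Om u -> supported Om v -> form v u = Cconj (form u v).
Proof.
  intros Hu Hv.
  assert (H : forall c, Im (Cconj c * form u v + c * form v u)%C = 0).
  { intros c.
    destruct (HK _ (supported_app _ _ _ Hu (supported_lscal _ c _ Hv))) as [_ H].
    rewrite form_combination in H.
    destruct (HK _ Hu) as [_ Iu]. destruct (HK _ Hv) as [_ Iv].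
    destruct (form u u), (form u v), (form v u), (form v v), c.
    simpl in *. subst. lra. }
  assert (H1 := H 1%C). assert (Hi := H Ci).
  destruct (form u v), (form v u). simpl in *. unfold Cconj; simpl.
  f_equal; lra.
Qed.

Lemma form_Cauchy_Schwarz u v :
  supported Om u -> supported Om v ->
  Cmod (form u v) ^ 2 <= Re (form u u) * Re (form v v).
Proof.
  intros Hu Hv.
  assert (Nu := proj1 (HK _ Hu)). assert (Nv := proj1 (HK _ Hv)).
  assert (Iv := proj2 (HK _ Hv)).
  set (b := Cmod (form u v) ^ 2).
  (* positivity of the form at u - r <u,v> v for every real r *)
  assert (H : forall r, 0 <= Re (form u u) - 2 * r * b + r ^ 2 * b * Re (form v v)).
  { intros r. set (c := (- r * form u v)%C).
    destruct (HK _ (supported_app _ _ _ Hu (supported_lscal _ c _ Hv))) as [H _].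
    rewrite form_combination, (form_hermitian u v Hu Hv) in H.
    unfold b. rewrite Cmod2_alt.
    unfold c in H. destruct (form u u), (form u v), (form v v).
    simpl in *. clear Iv. apply Rle_trans with (1 := H). right. ring. }
  assert (hb : 0 <= b) by apply pow2_ge_0.
  destruct Nv as [Nv|Nv].
  - specialize (H (/ Re (form v v))).
    apply Rmult_le_compat_r with (r := Re (form v v)) in H; [|lra].
    field_simplify in H; lra.
  - (* here [u - r <u,v> v] has squared norm [<u,u> - 2 r b]; the choice of [r]
       makes it [-1], unless [b = 0] *)
    rewrite <- Nv in *. destruct hb as [hb|hb]; [|lra].
    specialize (H ((Re (form u u) + 1) / (2 * b))).
    rewrite Rmult_0_r in H.
    replace (2 * ((Re (form u u) + 1) / (2 * b)) * b)
      with (Re (form u u) + 1) in H by (field; lra).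
    lra.
Qed.

(** The two indices move independently: this is what makes a family whose Gram
    products converge a Cauchy family. *)
Definition gram_limit {I J} (F : (I -> Prop) -> Prop) (G : (J -> Prop) -> Prop)
    (phi : I -> list (C * T)) (psi : J -> list (C * T)) (l : C) : Prop :=
  filterlim (fun ij => form (phi (fst ij)) (psi (snd ij)))
    (filter_prod F G) (locally l).

(** In [|phi_i - phi_j|^2 = <phi_i, phi_i> - <phi_i, phi_j> - <phi_j, phi_i>
    + <phi_j, phi_j>] all four products are close to [l]. *)
Lemma gram_limit_Cauchy {I} {F : (I -> Prop) -> Prop} {FF : ProperFilter F}
    (phi : I -> list (C * T)) (l : C) (eps : posreal) :
  F (fun i => supported Om (phi i)) -> gram_limit F F phi phi l ->
  exists P, F P /\ forall i j, P i -> P j ->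
    supported Om (phi i) /\ Re (form (phi i) (phi i)) < Re l + eps /\
    Re (form (phi i ++ lscal (-1) (phi j)) (phi i ++ lscal (-1) (phi j))) < eps.
Proof.
  intros HS HL.
  destruct (proj1 (filterlim_Cmod _ _) HL (mkposreal (eps / 4) ltac:(destruct eps; simpl; lra)))
    as [P Q HP HQ H]. simpl in H.
  exists (fun i => supported Om (phi i) /\ P i /\ Q i). split.
  { apply filter_and; auto. apply filter_and; auto. }
  assert (Hre : forall i j, P i -> Q j ->
    Rabs (Re (form (phi i) (phi j)) - Re l) < eps / 4).
  { intros i j Pi Qj. eapply Rle_lt_trans; [|exact (H i j Pi Qj)].
    apply (re_le_Cmod (form (phi i) (phi j) - l)). }
  intros i j [Si [Pi Qi]] [Sj [Pj Qj]].
  assert (He := cond_pos eps).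
  assert (Hii := Rabs_def2 _ _ (Hre i i Pi Qi)).
  assert (Hij := Rabs_def2 _ _ (Hre i j Pi Qj)).
  assert (Hji := Rabs_def2 _ _ (Hre j i Pj Qi)).
  assert (Hjj := Rabs_def2 _ _ (Hre j j Pj Qj)).
  split; [auto|]. split; [lra|].
  rewrite form_combination.
  destruct (form (phi i) (phi i)), (form (phi i) (phi j)),
    (form (phi j) (phi i)), (form (phi j) (phi j)). simpl in *. lra.
Qed.

Lemma form_lt u v (M eta : R) :
  supported Om u -> supported Om v -> 0 < M -> 0 < eta ->
  Re (form u u) < eta ^ 2 / M -> Re (form v v) <= M -> Cmod (form u v) < eta.
Proof.
  intros Hu Hv HM Heta Nu Nv.
  assert (CS := form_Cauchy_Schwarz u v Hu Hv).
  assert (Pu := proj1 (HK u Hu)). assert (Pv := proj1 (HK v Hv)).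
  assert (Re (form u u) * M < eta ^ 2).
  { apply Rmult_lt_compat_r with (r := M) in Nu; auto.
    field_simplify in Nu; lra. }
  assert (C0 := Cmod_ge_0 (form u v)). nra.
Qed.

(** Both families are Cauchy and bounded for the seminorm of the form, so by
    Cauchy-Schwarz their mutual products are Cauchy in [C]: convergence on the
    diagonal implies convergence off the diagonal. *)
Lemma gram_limit_ex {I J} {F : (I -> Prop) -> Prop} {G : (J -> Prop) -> Prop}
    {FF : ProperFilter F} {FG : ProperFilter G}
    (phi : I -> list (C * T)) (psi : J -> list (C * T)) (lF lG : C) :
  F (fun i => supported Om (phi i)) -> G (fun j => supported Om (psi j)) ->
  gram_limit F F phi phi lF -> gram_limit G G psi psi lG ->
  exists l, gram_limit F G phi psi l.
Proof.
  intros SF SG HF HG. apply ex_filterlim_Cauchy. intros eps.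
  set (M := Rmax (Re lF) (Re lG) + 1).
  assert (MF := Rmax_l (Re lF) (Re lG)). assert (MG := Rmax_r (Re lF) (Re lG)).
  destruct (gram_limit_Cauchy phi lF (mkposreal 1 Rlt_0_1) SF HF) as [P1 [FP1 H1]].
  destruct (gram_limit_Cauchy psi lG (mkposreal 1 Rlt_0_1) SG HG) as [Q1 [GQ1 K1]].
  simpl in H1, K1.
  assert (HM : 0 < M).
  { destruct (filter_ex P1 FP1) as [i Pi]. destruct (H1 i i Pi Pi) as [Si [Bi _]].
    assert (Ni := proj1 (HK _ Si)). unfold M. lra. }
  assert (He := cond_pos eps).
  assert (Hd : 0 < (eps / 2) ^ 2 / M) by (apply Rdiv_lt_0_compat; nra).
  destruct (gram_limit_Cauchy phi lF (mkposreal _ Hd) SF HF) as [P2 [FP2 H2]].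
  destruct (gram_limit_Cauchy psi lG (mkposreal _ Hd) SG HG) as [Q2 [GQ2 K2]].
  simpl in H2, K2.
  exists (fun ij => (P1 (fst ij) /\ P2 (fst ij)) /\ (Q1 (snd ij) /\ Q2 (snd ij))).
  split.
  { exists (fun i => P1 i /\ P2 i) (fun j => Q1 j /\ Q2 j);
      [now apply filter_and..|auto]. }
  intros [i j] [i' j'] [[Pi1 Pi2] [Qj1 Qj2]] [[Pi1' Pi2'] [Qj1' Qj2']].
  simpl in *.
  destruct (H1 i' i' Pi1' Pi1') as [Si' [Bi' _]].
  destruct (K1 j j Qj1 Qj1) as [Sj [Bj _]].
  destruct (H2 i i' Pi2 Pi2') as [Si [_ Di]].
  destruct (K2 j j' Qj2 Qj2') as [_ [_ Dj]].
  destruct (K1 j' j' Qj1' Qj1') as [Sj' _].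
  (* <phi_i, psi_j> - <phi_i', psi_j'>
     = <phi_i - phi_i', psi_j> + <phi_i', psi_j - psi_j'> *)
  replace (form (phi i) (psi j) - form (phi i') (psi j'))%C
    with (form (phi i ++ lscal (-1) (phi i')) (psi j)
          + Cconj (form (psi j ++ lscal (-1) (psi j')) (phi i')))%C.
  - eapply Rle_lt_trans; [apply Cmod_triangle|]. rewrite Cmod_conj.
    assert (A : Cmod (form (phi i ++ lscal (-1) (phi i')) (psi j)) < eps / 2).
    { apply form_lt with M; auto; try lra; unfold M;
        auto using supported_app, supported_lscal; lra. }
    assert (B : Cmod (form (psi j ++ lscal (-1) (psi j')) (phi i')) < eps / 2).
    { apply form_lt with M; auto; try lra; unfold M;
        auto using supported_app, supported_lscal; lra. }
    lra.
  - rewrite <- form_hermitian; auto using supported_app, supported_lscal.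
    rewrite form_app_l, form_app_r, form_lscal_l, form_lscal_r.
    apply injective_projections; simpl; ring.
Qed.

End Form.

(** * Kernels depending on x + sigma y *)

Section Translation.
Context (sigma : R) (sigma0 : sigma <> 0).

Definition kern (f : R -> C) (x y : R) : C := f (x + sigma * y).

Definition twisted_sum (Om : R -> Prop) (s : R) : Prop :=
  exists x y, Om x /\ Om y /\ s = x + sigma * y.

Lemma twisted_sum_nbhd (Om : R -> Prop) (s : R) :
  open Om -> twisted_sum Om s -> locally s (twisted_sum Om).
Proof.
  intros HO [a [b [Ha [Hb ->]]]]. destruct (HO a Ha) as [d Hd].
  exists d. intros z Bz. exists (a + (z - (a + sigma * b))), b.
  repeat split; auto.
  - apply Hd. change (Rabs (a + (z - (a + sigma * b)) - a) < d).
    rewrite Rplus_minus_l. exact Bz.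
  - unfold Rminus. lra.
Qed.

Definition dirac (a : R) : list (C * R) := (RtoC 1, a) :: nil.

(** The vector [(k_(a+h) - k_a) / h]. *)
Definition diff_quot (a h : R) : list (C * R) :=
  ((/ h)%C, a + h) :: ((- / h)%C, a) :: nil.

Lemma form_dirac f a b : form (kern f) (dirac a) (dirac b) = f (a + sigma * b).
Proof.
  unfold form, dirac, kern; simpl. apply injective_projections; simpl; ring.
Qed.

Lemma form_diff_quot_dirac f a b h :
  form (kern f) (diff_quot a h) (dirac b)
  = ((f (a + sigma * b + h)%R - f (a + sigma * b)%R) / h)%C.
Proof.
  unfold form, dirac, kern, diff_quot; simpl.
  replace (a + h + sigma * b) with (a + sigma * b + h) by ring.
  replace (Cconj 1) with (RtoC 1).
  - unfold Cdiv. ring.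
  - apply injective_projections; simpl; ring.
Qed.

Lemma form_diff_quot f a b h t :
  h <> 0 -> t <> 0 ->
  form (kern f) (diff_quot a h) (diff_quot b t)
  = (sigma * second_diff f (a + sigma * b) (h, sigma * t)%R)%C.
Proof.
  intros h0 t0.
  unfold form, kern, diff_quot, second_diff; simpl.
  replace (a + h + sigma * (b + t)) with (a + sigma * b + h + sigma * t) by ring.
  replace (a + h + sigma * b) with (a + sigma * b + h) by ring.
  replace (a + sigma * (b + t)) with (a + sigma * b + sigma * t) by ring.
  replace (Cconj (- / t)%C) with (- / t)%C.
  replace (Cconj (/ t)%C) with (/ t)%C.
  - rewrite !RtoC_mult. field.
    repeat split; intros K; apply RtoC_inj in K; auto.
  - rewrite <- RtoC_inv by auto. apply injective_projections; simpl; ring.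
  - rewrite <- RtoC_inv by auto. apply injective_projections; simpl; ring.
Qed.

(** The increment [t] of the second variable moves the argument of [f] by
    [sigma * t], hence the factor [sigma]. *)
Lemma gram_limit_diff_quot f a b (m : C) :
  gram_limit (kern f) (locally' 0) (locally' 0) (diff_quot a) (diff_quot b)
    (sigma * m)%C <->
  filterlim (second_diff f (a + sigma * b))
    (filter_prod (locally' 0) (locally' 0)) (locally m).
Proof.
  set (F := filter_prod (locally' 0) (locally' 0)).
  assert (nz : forall c : R, c <> 0 -> filterlim (fun ht : R * R => (fst ht, c * snd ht)) F F).
  { intros c c0. apply filterlim_pair; [apply filterlim_fst|].
    eapply filterlim_comp; [apply filterlim_snd|now apply filterlim_locally'_scal]. }
  assert (ev : F (fun ht => fst ht <> 0 /\ snd ht <> 0)).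
  { eapply Filter_prod; [apply (locally'_neq 0)..|]. auto. }
  assert (sigma0' : RtoC sigma <> 0%C) by (intros K; apply RtoC_inj in K; auto).
  assert (e : forall t, sigma * (/ sigma * t) = t) by (intros; field; auto).
  assert (cancel : forall z : C, (/ sigma * (sigma * z))%C = z) by (intros; field; auto).
  split; intros H.
  - replace m with (/ sigma * (sigma * m))%C by apply cancel.
    eapply filterlim_ext_loc;
      [|apply filterlim_C_scal, (filterlim_comp _ _ _ _ _ _ _ _ (nz (/ sigma) (Rinv_neq_0_compat _ sigma0)) H)].
    generalize ev. apply filter_imp. intros [h t] [h0 t0]. simpl in h0, t0. simpl fst; simpl snd.
    rewrite form_diff_quot; auto.
    + rewrite e. apply cancel.
    + apply Rmult_integral_contrapositive_currified; auto.
      now apply Rinv_neq_0_compat.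
  - eapply filterlim_ext_loc;
      [|apply (filterlim_C_scal sigma), (filterlim_comp _ _ _ _ _ _ _ _ (nz sigma sigma0) H)].
    generalize ev. apply filter_imp. intros [h t] [h0 t0]. simpl in h0, t0. simpl fst; simpl snd.
    now rewrite form_diff_quot.
Qed.

Lemma supported_dirac (Om : R -> Prop) a : Om a -> supported Om (dirac a).
Proof. repeat constructor; auto. Qed.

Lemma supported_diff_quot (Om : R -> Prop) a :
  open Om -> Om a -> locally' 0 (fun h => supported Om (diff_quot a h)).
Proof.
  intros HO Ha. generalize (locally'_nbhd a _ (HO a Ha)). apply filter_imp.
  intros h Hh. repeat constructor; auto.
Qed.

(** [gram_limit_ex] applied to the kernel vectors [k_x], with [x] near [a] and near
    [b], gives a limit of [f] at [a + sigma * b]; it is the value of [f] because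
    the neighbourhoods contain [a] and [b] themselves. *)
Lemma psd_continuous (Om : R -> Prop) f :
  open Om -> psd_kernel (kern f) Om ->
  (forall a, Om a -> continuous f (a + sigma * a)) ->
  forall s, twisted_sum Om s -> continuous f s.
Proof.
  intros HO HP HC s [a [b [Ha [Hb Es]]]].
  assert (cont : forall a b : R, filterlim (fun xy : R * R => fst xy + sigma * snd xy)
    (filter_prod (locally a) (locally b)) (locally (a + sigma * b))).
  { intros x y. apply (filterlim_comp_2 (G := locally x) (H := locally (sigma * y))
      fst (fun xy => sigma * snd xy) Rplus).
    - apply filterlim_fst.
    - eapply filterlim_comp; [apply filterlim_snd|].
      exact (filterlim_scal_r (V := R_NormedModule) sigma y).
    - exact (filterlim_plus (V := R_NormedModule) x (sigma * y)). }
  assert (G : forall c, Om c ->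
    gram_limit (kern f) (locally c) (locally c) dirac dirac (f (c + sigma * c))).
  { intros c Hc.
    apply filterlim_ext with (f := fun xy : R * R => f (fst xy + sigma * snd xy)).
    { intros xy. symmetry. apply form_dirac. }
    eapply filterlim_comp; [apply (cont c c)|]. now apply HC. }
  assert (Sp : forall c, Om c -> locally c (fun x => supported Om (dirac x))).
  { intros c Hc. generalize (HO c Hc). apply filter_imp. apply supported_dirac. }
  destruct (gram_limit_ex (kern f) HP dirac dirac _ _ (Sp a Ha) (Sp b Hb) (G a Ha) (G b Hb))
    as [l Hl].
  assert (L : filterlim f (locally s) (locally l)).
  { apply filterlim_ext with
      (f := fun x : R => form (kern f) (dirac (x - sigma * b)) (dirac b)).
    - intros x. rewrite form_dirac. f_equal. unfold Rminus. lra.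
    - refine (filterlim_comp _ _ _ (fun x : R => (x - sigma * b, b)) _ _ _ _ _ Hl).
      apply (filterlim_pair (fun x => x - sigma * b) (fun _ => b)).
      + replace a with (s - sigma * b) by lra.
        exact (continuous_minus (V := R_NormedModule) (fun x => x) (fun _ => sigma * b) s
          (continuous_id _) (continuous_const _ _)).
      + intros P HPb. unfold filtermap.
        apply filter_forall. intros _. now apply locally_singleton. }
  assert (E : l = f s).
  { apply (filterlim_C_unique (F := at_point s) f).
    - eapply filterlim_filter_le_1; [|exact L]. intros P HPs. exact (locally_singleton s P HPs).
    - intros P HPs. exact (locally_singleton (T := C_UniformSpace) (f s) P HPs). }
  rewrite E in L. exact L.
Qed.

(** The derivative at [a + sigma * b] is the limit of the products of the
    difference quotients at [a] with the constant family [k_b]. *)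
Lemma ex_derive_twisted_sum (Om : R -> Prop) f :
  open Om -> psd_kernel (kern f) Om ->
  (forall a, Om a -> exists m,
    filterlim (second_diff f (a + sigma * a))
      (filter_prod (locally' 0) (locally' 0)) (locally m)) ->
  forall s, twisted_sum Om s ->
  exists l, is_derive (K := R_AbsRing) (V := C_R_NormedModule) f s l.
Proof.
  intros HO HP HD s [a [b [Ha [Hb ->]]]].
  destruct (HD a Ha) as [m Hm]. apply gram_limit_diff_quot in Hm.
  assert (G : gram_limit (kern f) (at_point b) (at_point b) dirac dirac
    (form (kern f) (dirac b) (dirac b))).
  { intros P HPl. exists (eq b) (eq b); try reflexivity.
    intros x y <- <-. now apply locally_singleton. }
  destruct (gram_limit_ex (kern f) HP (diff_quot a) dirac _ _
    (supported_diff_quot Om a HO Ha) (supported_dirac Om b Hb) Hm G) as [l Hl].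
  exists l. apply is_derive_quot.
  apply filterlim_ext with (f := fun h => form (kern f) (diff_quot a h) (dirac b)).
  { intros h. apply form_diff_quot_dirac. }
  refine (filterlim_comp _ _ _ (fun h : R => (h, b)) _ _ _ _ _ Hl).
  apply (filterlim_pair (fun h => h) (fun _ => b)).
  - apply filterlim_id.
  - intros P HPb. unfold filtermap. now apply filter_forall.
Qed.

Lemma second_diff_limit_ex (Om : R -> Prop) f :
  open Om -> psd_kernel (kern f) Om ->
  (forall a, Om a -> exists m,
    filterlim (second_diff f (a + sigma * a))
      (filter_prod (locally' 0) (locally' 0)) (locally m)) ->
  forall s, twisted_sum Om s ->
  exists m, filterlim (second_diff f s)
      (filter_prod (locally' 0) (locally' 0)) (locally m).
Proof.
  intros HO HP HD s [a [b [Ha [Hb ->]]]].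
  destruct (HD a Ha) as [ma Hma]. destruct (HD b Hb) as [mb Hmb].
  apply gram_limit_diff_quot in Hma. apply gram_limit_diff_quot in Hmb.
  destruct (gram_limit_ex (kern f) HP (diff_quot a) (diff_quot b) _ _
    (supported_diff_quot Om a HO Ha) (supported_diff_quot Om b HO Hb) Hma Hmb)
    as [l Hl].
  exists (/ sigma * l)%C. apply gram_limit_diff_quot.
  replace (sigma * (/ sigma * l))%C with l; auto.
  field. intros K; apply RtoC_inj in K; auto.
Qed.

(** For a list [w] of pairs [(c, x)], the vectors [sum c (k_(x+h) - k_x) / h] have
    nonnegative squared norms, which converge as [h] tends to [0] to the value
    at [w] of the form of [sigma * f2]. *)
Lemma psd_second_derivative (Om : R -> Prop) f (f2 : R -> C) :
  open Om -> psd_kernel (kern f) Om ->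
  (forall s, twisted_sum Om s -> filterlim (second_diff f s)
      (filter_prod (locally' 0) (locally' 0)) (locally (f2 s))) ->
  psd_kernel (kern (fun s => sigma * f2 s)%C) Om.
Proof.
  intros HO HP HD w Hw.
  set (W := fun h => flat_map (fun p => lscal (fst p) (diff_quot (snd p) h)) w).
  assert (SW : locally' 0 (fun h => supported Om (W h))).
  { unfold W. clear W. induction Hw as [|p w Hp Hw IH]; cbn [flat_map].
    - apply filter_forall. constructor.
    - generalize (filter_and _ _ (supported_diff_quot Om _ HO Hp) IH).
      apply filter_imp. intros h [H1 H2].
      now apply supported_app; [apply supported_lscal|]. }
  apply (filterlim_C_nonneg (F := locally' 0) (fun h => form (kern f) (W h) (W h))).
  { generalize SW. apply filter_imp. intros h Sh. now apply HP. }
  apply filterlim_ext with (f := fun h => lsum (fun p => lsum (fun q =>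
    fst p * Cconj (fst q)
      * form (kern f) (diff_quot (snd p) h) (diff_quot (snd q) h))%C w) w).
  { intros h. unfold W, form at 2. rewrite lsum_flat_map.
    apply lsum_ext; intros p _.
    transitivity (form (kern f) (lscal (fst p) (diff_quot (snd p) h)) (W h));
      [|reflexivity].
    unfold W. rewrite form_flat_map_r. apply lsum_ext; intros q _.
    rewrite form_lscal_l, form_lscal_r. ring. }
  assert (Hw' := proj1 (Forall_forall _ _) Hw).
  apply (filterlim_lsum (fun h p => lsum (fun q => _) w)). intros p Hp.
  apply (filterlim_lsum (fun h q => _)). intros q Hq.
  unfold kern at 2.
  replace (sigma * f2 (snd p + sigma * snd q)%R * fst p * Cconj (fst q))%C
    with (fst p * Cconj (fst q) * (sigma * f2 (snd p + sigma * snd q)%R))%C by ring.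
  apply filterlim_C_scal.
  assert (L : gram_limit (kern f) (locally' 0) (locally' 0)
    (diff_quot (snd p)) (diff_quot (snd q)) (sigma * f2 (snd p + sigma * snd q)%R)%C).
  { apply gram_limit_diff_quot, HD. exists (snd p), (snd q).
    repeat split; [apply (Hw' p Hp)|apply (Hw' q Hq)]. }
  refine (filterlim_comp _ _ _ (fun h : R => (h, h)) _ _ _ _ _ L).
  apply (filterlim_pair (fun h => h) (fun h => h)); apply filterlim_id.
Qed.
End Translation.

(** * The classes C^k and the induction on the order *)

Lemma class_C_subset k (U V : R -> Prop) f :
  (forall x, V x -> U x) -> class_C k U f -> class_C k V f.
Proof.
  revert f. induction k as [|k IH]; simpl; intros f H.
  - auto.
  - intros [f' [H1 H2]]. exists f'. auto.
Qed.

Lemma is_derive_unique_C (f : R -> C) x l m :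
  is_derive (K := R_AbsRing) (V := C_R_NormedModule) f x l ->
  is_derive (K := R_AbsRing) (V := C_R_NormedModule) f x m -> l = m.
Proof.
  intros Hl Hm. apply is_derive_quot in Hl. apply is_derive_quot in Hm.
  exact (filterlim_C_unique _ _ _ Hl Hm).
Qed.

Lemma class_C_ext k (U : R -> Prop) f g :
  open U -> (forall x, U x -> f x = g x) -> class_C k U f -> class_C k U g.
Proof.
  intros HU E. destruct k as [|k]; simpl.
  - intros H x Ux. apply (continuous_ext_loc g f); auto.
    generalize (HU x Ux). apply filter_imp. auto.
  - intros [f' [H1 H2]]. exists f'. split; auto. intros x Ux.
    apply (is_derive_ext_loc (V := C_R_NormedModule) f); auto.
    generalize (HU x Ux). apply filter_imp. auto.
Qed.

Lemma class_C_scal k (U : R -> Prop) (c : R) f :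
  class_C k U f -> class_C k U (fun x => c * f x)%C.
Proof.
  revert f. induction k as [|k IH]; simpl; intros f.
  - intros H x Ux. exact (filterlim_C_scal c f (f x) (H x Ux)).
  - intros [f' [H1 H2]]. exists (fun x => c * f' x)%C. split; auto.
    intros x Ux. apply is_derive_quot.
    apply filterlim_ext with (f := fun h : R => (c * ((f (x + h)%R - f x) / h))%C).
    { intros h. unfold Cdiv. ring. }
    now apply filterlim_C_scal, is_derive_quot, H1.
Qed.

Lemma class_C_continuous k (U : R -> Prop) f :
  class_C k U f -> forall x, U x -> continuous f x.
Proof.
  destruct k as [|k]; simpl; auto.
  intros [f' [H _]] x Ux.
  apply (ex_derive_continuous (V := C_R_NormedModule)). exists (f' x). auto.
Qed.

Lemma choice_on (S : R -> Prop) (P : R -> C -> Prop) :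
  (forall s, S s -> exists l, P s l) -> exists g, forall s, S s -> P s (g s).
Proof.
  intros H. exists (fun s => epsilon (inhabits (RtoC 0)) (P s)).
  intros s Ss. now apply epsilon_spec, H.
Qed.

(** Two derivatives are gained at each step of the induction: [sigma * g2], with
    [g2] the second derivative of [f] found on the whole of the twisted sum set,
    is again positive semidefinite and agrees on [U] with [sigma] times the given
    second derivative. *)
Theorem psd_class_C (sigma : R) (n : nat) (Om U : R -> Prop) (f : R -> C) :
  sigma <> 0 -> open Om -> psd_kernel (kern sigma f) Om -> open U ->
  (forall s, U s -> twisted_sum sigma Om s) ->
  (forall a, Om a -> U (a + sigma * a)) ->
  class_C (2 * n) U f -> class_C (2 * n) (twisted_sum sigma Om) f.
Proof.
  intros sigma0 HO HP HU US UD. revert f HP.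
  induction n as [|n IH]; intros f HP.
  - intros H. refine (psd_continuous sigma Om f HO HP _).
    intros a Ha. apply H. auto.
  - replace (2 * S n)%nat with (S (S (2 * n))) by lia.
    intros [f1 [D1 [f2 [D2 H2]]]].
    assert (SD : forall a, Om a -> exists m,
      filterlim (second_diff f (a + sigma * a))
        (filter_prod (locally' 0) (locally' 0)) (locally m)).
    { intros a Ha. exists (f2 (a + sigma * a)). apply second_diff_limit with f1.
      - generalize (HU _ (UD a Ha)). apply filter_imp. auto.
      - generalize (HU _ (UD a Ha)). apply filter_imp. auto.
      - apply (class_C_continuous _ _ _ H2); auto. }
    destruct (choice_on _ _ (ex_derive_twisted_sum sigma sigma0 Om f HO HP SD)) as [g1 G1].
    destruct (choice_on _ _ (second_diff_limit_ex sigma sigma0 Om f HO HP SD)) as [g2 G2].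
    assert (G1' : forall s, twisted_sum sigma Om s ->
      is_derive (K := R_AbsRing) (V := C_R_NormedModule) g1 s (g2 s)).
    { intros s Ss. apply is_derive_of_second_diff with f; auto.
      generalize (twisted_sum_nbhd sigma Om s HO Ss). apply filter_imp. auto. }
    exists g1. split; auto. exists g2. split; auto.
    assert (E1 : forall x, U x -> f1 x = g1 x).
    { intros x Ux. apply (is_derive_unique_C f x); auto. }
    assert (E2 : forall x, U x -> f2 x = g2 x).
    { intros x Ux. apply (is_derive_unique_C g1 x); auto.
      apply (is_derive_ext_loc (V := C_R_NormedModule) f1); auto.
      generalize (HU x Ux). apply filter_imp. auto. }
    assert (H := IH (fun s => sigma * g2 s)%C
      (psd_second_derivative sigma sigma0 Om f g2 HO HP G2)
      (class_C_scal _ _ _ _ (class_C_ext _ _ _ _ HU E2 H2))).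
    apply (class_C_scal _ _ (/ sigma)) in H.
    revert H. apply class_C_ext.
    + intros s. apply twisted_sum_nbhd; auto.
    + intros x _. rewrite RtoC_inv by auto. field.
      intros K; apply RtoC_inj in K; auto.
Qed.

(** * From finite families of points to lists *)

Lemma sum_n_m_nth {T : Type} (g : T -> C) (d : T) (u : list T) :
  sum_n_m (fun i => g (nth (i - 1) u d)) 1 (length u) = lsum g u.
Proof.
  induction u as [|p u IH].
  - rewrite sum_n_m_zero by (simpl; lia). reflexivity.
  - cbn [length lsum fold_right]. rewrite sum_Sn_m, <- sum_n_m_S by lia.
    apply (f_equal2 Cplus); [reflexivity|].
    transitivity (sum_n_m (fun i => g (nth (i - 1) u d)) 1 (length u));
      [|exact IH].
    apply sum_n_m_ext_loc. intros [|k] Hk; [lia|].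
    now replace (S k - 1)%nat with k by lia.
Qed.

Lemma psd_kernel_of_families (K : R -> R -> C) (Om : R -> Prop) :
  (forall (m : nat) (x : nat -> R) (xi : nat -> C),
    (forall j : nat, (1 <= j <= m)%nat -> Om (x j)) ->
    C_nonneg (sum_n_m (fun i => sum_n_m
      (fun j => (K (x i) (x j) * xi i * Cconj (xi j))%C) 1 m) 1 m)) ->
  psd_kernel K Om.
Proof.
  intros H u Hu.
  (* the default [d] is never reached: the indices run from 1 to [length u] *)
  set (d := (RtoC 0, 0)).
  specialize (H (length u) (fun j => snd (nth (j - 1) u d))
    (fun j => fst (nth (j - 1) u d))).
  replace (form K u u) with (sum_n_m (fun i => sum_n_m (fun j =>
    (K (snd (nth (i - 1) u d)) (snd (nth (j - 1) u d))
      * fst (nth (i - 1) u d) * Cconj (fst (nth (j - 1) u d)))%C)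
      1 (length u)) 1 (length u)).
  - apply H. intros j Hj. apply (proj1 (Forall_forall _ _) Hu).
    apply nth_In. lia.
  - unfold form. rewrite <- (sum_n_m_nth _ d u).
    apply sum_n_m_ext. intros i. now rewrite <- (sum_n_m_nth _ d u).
Qed.

Theorem theorem3p22 (n : nat) (hn : (1 <= n)%nat)
    (Omega : R -> Prop) (Omega_open : open Omega)
    (Omega_nonempty : exists x : R, Omega x) :
  (forall (f : R -> C) (U : R -> Prop),
     positive_definite Omega f ->
     open U ->
     (forall s : R, U s -> diff_set Omega s) ->
     U 0 ->
     class_C (2 * n) U f ->
     class_C (2 * n) (diff_set Omega) f)
  /\
  (forall (f : R -> C) (U : R -> Prop),
     co_positive_definite Omega f ->
     open U ->
     (forall s : R, U s -> sum_set Omega s) ->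
     (forall x : R, Omega x -> U (x + x)) ->
     class_C (2 * n) U f ->
     class_C (2 * n) (sum_set Omega) f).
Proof.
  split; intros f U Hf HU US UD HC.
  - assert (E : forall x y, x + -1 * y = x - y) by (intros; ring).
    assert (D : forall s, diff_set Omega s <-> twisted_sum (-1) Omega s).
    { intros s. split; intros [x [y [Hx [Hy ->]]]]; exists x, y;
        rewrite E; auto. }
    apply class_C_subset with (twisted_sum (-1) Omega); [apply D|].
    apply psd_class_C with U; auto.
    + intros K. lra.
    + apply psd_kernel_of_families. intros m x xi Hx. unfold kern.
      erewrite sum_n_m_ext; [exact (Hf m x xi Hx)|].
      intros i. apply sum_n_m_ext. intros j. now rewrite E.
    + intros s Us. apply D. auto.
    + intros a _. now replace (a + -1 * a) with 0 by ring.
  - assert (E : forall x y, x + 1 * y = x + y) by (intros; ring).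
    assert (D : forall s, sum_set Omega s <-> twisted_sum 1 Omega s).
    { intros s. split; intros [x [y [Hx [Hy ->]]]]; exists x, y;
        rewrite E; auto. }
    apply class_C_subset with (twisted_sum 1 Omega); [apply D|].
    apply psd_class_C with U; auto.
    + apply psd_kernel_of_families. intros m x xi Hx. unfold kern.
      erewrite sum_n_m_ext; [exact (Hf m x xi Hx)|].
      intros i. apply sum_n_m_ext. intros j. now rewrite E.
    + intros s Us. apply D. auto.
    + intros a Ha. rewrite E. auto.
Qed.
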